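(* Let $\gamma\in(0,1)$, $\xi\in(\gamma,1)$, $\lambda_h=\left(\sqrt{(1-\gamma)\xi}-\sqrt{(1-\xi)\gamma}\right)^2$, $\Lambda_h=\left(\sqrt{(1-\gamma)\xi}+\sqrt{(1-\xi)\gamma}\right)^2$, and define $\tau=\left(\frac{\sqrt{\Lambda_h}-\sqrt{\lambda_h}}{\sqrt{\Lambda_h}+\sqrt{\lambda_h}}\right)^2$, $c=\frac{4}{(\sqrt{1/\Lambda_h}+\sqrt{1/\lambda_h})^2}$, $\alpha=(1-\sqrt\tau)^2$, $\beta=(1+\sqrt\tau)^2$, $\omega=\frac{4}{(\sqrt{\beta-c}+\sqrt{\alpha-c})^2}$, $\kappa=\left(\frac{\sqrt{\beta-c}-\sqrt{\alpha-c}}{\sqrt{\beta-c}+\sqrt{\alpha-c}}\right)^2$. Let $\Pi_0(x)=1$, $\Pi_1(x)=1-x$, and $\Pi_t(x)=(1+\kappa-x)\Pi_{t-1}(x)-\kappa\Pi_{t-2}(x)$ for $t\ge2$ (the orthogonal family for $\mu_\kappa$). Define $R_t(x)=\Pi_t(\omega(x-c))/\Pi_t(-\omega c)$. Then $R_t(0)=1$, $\deg(R_t)=t$, and the family $\{R_t\}$ is orthogonal with respect to the density $\frac{x\,\mu_\tau(x)}{x-c}$ on $[\alpha,\beta]$.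
   Context: For $r\in(0,1)$, $\mu_r(x)=\frac{\sqrt{((1+\sqrt r)^2-x)_+(x-(1-\sqrt r)^2)_+}}{2\pi r x}$ is the Marchenko–Pastur density with parameter $r$; in particular $\mu_\tau$ is supported on $[\alpha,\beta]$. $y_+=\max\{y,0\}$. *)

(* Defs.v *)
From HB Require Import structures.
From mathcomp Require Import all_boot all_order all_algebra.
From mathcomp Require Import all_classical all_reals all_analysis.
Set Implicit Arguments. Unset Strict Implicit. Unset Printing Implicit Defensive.
Import Order.TTheory GRing.Theory Num.Theory.
Local Open Scope ring_scope.

Section Defs.
Variable R : realType.

Definition pos_part (y : R) : R := Num.max y 0.

(* Marchenko–Pastur density with parameter r *)
Definition mp_density (r x : R) : R :=
  Num.sqrt (pos_part ((1 + Num.sqrt r) ^+ 2 - x) * pos_part (x - (1 - Num.sqrt r) ^+ 2))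
  / (2 * pi * r * x).

Definition lam_h (g xi : R) : R :=
  (Num.sqrt ((1 - g) * xi) - Num.sqrt ((1 - xi) * g)) ^+ 2.
Definition Lam_h (g xi : R) : R :=
  (Num.sqrt ((1 - g) * xi) + Num.sqrt ((1 - xi) * g)) ^+ 2.
Definition tau_p (g xi : R) : R :=
  ((Num.sqrt (Lam_h g xi) - Num.sqrt (lam_h g xi)) /
   (Num.sqrt (Lam_h g xi) + Num.sqrt (lam_h g xi))) ^+ 2.
Definition c_p (g xi : R) : R :=
  4 / (Num.sqrt (1 / Lam_h g xi) + Num.sqrt (1 / lam_h g xi)) ^+ 2.
Definition alpha_p (g xi : R) : R := (1 - Num.sqrt (tau_p g xi)) ^+ 2.
Definition beta_p (g xi : R) : R := (1 + Num.sqrt (tau_p g xi)) ^+ 2.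
Definition omega_p (g xi : R) : R :=
  4 / (Num.sqrt (beta_p g xi - c_p g xi) + Num.sqrt (alpha_p g xi - c_p g xi)) ^+ 2.
Definition kappa_p (g xi : R) : R :=
  ((Num.sqrt (beta_p g xi - c_p g xi) - Num.sqrt (alpha_p g xi - c_p g xi)) /
   (Num.sqrt (beta_p g xi - c_p g xi) + Num.sqrt (alpha_p g xi - c_p g xi))) ^+ 2.

Fixpoint Pi_poly (k : R) (t : nat) : {poly R} :=
  match t with
  | 0 => 1
  | 1 => 1 - 'X
  | (u.+1 as v).+1 => ((1 + k)%:P - 'X) * Pi_poly k v - k%:P * Pi_poly k u
  end.

Definition R_poly (g xi : R) (t : nat) : {poly R} :=
  (Pi_poly (kappa_p g xi) t).[- (omega_p g xi * c_p g xi)]^-1 *: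
  (Pi_poly (kappa_p g xi) t \Po (omega_p g xi *: ('X - (c_p g xi)%:P))).

Definition weight (g xi x : R) : R :=
  x * mp_density (tau_p g xi) x / (x - c_p g xi).

End Defs.

(* Main.v *)
(** Substituting y = omega (x - c) turns the weight into a multiple of w(y) / y,
    where w(y) = sqrt (4 kappa - (1 + kappa - y)^2), so the claim is that the
    Pi_t are orthogonal for w(y) / y.  By the three-term recurrence it is enough
    that J_t, the integral of Pi_t w / y, vanishes for t >= 1.  Since
    Pi_{t+1} - Pi_t = - y U_t with U_t a rescaled Chebyshev polynomial of the
    second kind, and w U_t (t >= 1) has an algebraic primitive vanishing at both
    ends of the support, J_t does not depend on t >= 1.  An invariant of the
    recurrence gives |Pi_t w / y| <= 2 kappa^((t+1)/2) / sqrt y, whence J_t -> 0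
    if kappa < 1.  If kappa = 1 (this happens: xi = 1 - gamma gives c = alpha,
    and the weight is then unbounded at alpha), Pi_1 w / y is the derivative of
    w (4 - y) / 2. *)

Require Import Defs.
From HB Require Import structures.
From mathcomp Require Import all_boot all_order all_algebra.
From mathcomp Require Import all_classical all_reals all_analysis.
From mathcomp Require Import measurable_realfun ring lra.
Set Implicit Arguments. Unset Strict Implicit. Unset Printing Implicit Defensive.
Import Order.TTheory GRing.Theory Num.Theory.
Import numFieldNormedType.Exports.
Local Open Scope classical_set_scope.
Local Open Scope ring_scope.

(** * Fundamental theorem of calculus for integrands that may blow up at the endpoints *)

Section ImproperFTC.
Variable R : realType.
Notation mu := (@lebesgue_measure R).
Implicit Types (f g F G : R -> R) (a b : R).

Lemma measurable_fun_itvoo_continuous f a b :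
  {in `]a, b[, continuous f} -> measurable_fun `]a, b[ f.
Proof.
move=> cf; apply: subspace_continuous_measurable_fun => //.
by apply: continuous_in_subspaceT => x; rewrite inE/=; exact: cf.
Qed.

(** Monotone convergence along compact subintervals exhausting the open one: the usual theorem
    applies on each of them, and continuity of [F] at the endpoints gives the limit. No boundedness
    of [f] enters. *)
Lemma ge0_continuous_FTC2_itvoo f F a b : a < b -> continuous F ->
  {in `]a, b[, continuous f} ->
  {in `]a, b[, forall x : R, is_derive x 1 F (f x)} ->
  {in `]a, b[, forall x, 0 <= f x} ->
  (\int[mu]_(x in `]a, b[) (f x)%:E = (F b - F a)%:E)%E.
Proof.
move=> ab cF cf dF f0.
(* The shift to [n.+3] gives [2 * e n < b - a], so every compact subinterval is nondegenerate. *)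
pose e n : R := (b - a) * (n.+3%:R)^-1.
have ba : 0 < b - a by rewrite subr_gt0.
have e_gt0 n : 0 < e n by rewrite mulr_gt0// invr_gt0.
have e_lt n : a + e n < b - e n.
  have : e n *+ 2 < b - a.
    rewrite /e -mulrnAr -mulr_natr gtr_pMr// mulrC ltr_pdivrMr// mul1r.
    by rewrite ltr_nat.
  by rewrite mulr2n; move: (e_gt0 n); lra.
pose D n := `[a + e n, b - e n]%classic.
have De : `]a, b[%classic = \bigcup_n D n.
  apply/seteqP; split => x /=; rewrite in_itv/=.
    move=> /andP[ax xb].
    have m0 : 0 < Num.min (x - a) (b - x) / (b - a).
      by rewrite divr_gt0// lt_min !subr_gt0 ax.
    have [k] := ltr_add_invr m0; rewrite add0r ltr_pdivlMr// => Hk.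
    have ek : e k < Num.min (x - a) (b - x).
      apply: le_lt_trans Hk; rewrite /e mulrC ler_wpM2r// ?(ltW ba)//.
      by rewrite lef_pV2 ?posrE ?ltr0n// ler_nat ltnW.
    exists k => //; rewrite /D/= in_itv/=.
    by move: ek; rewrite lt_min => /andP[]; lra.
  move=> [n _]; rewrite /D/= in_itv/= => /andP[]; move: (e_gt0 n).
  by lra.
have sD n x : `[a + e n, b - e n]%classic x -> x \in `]a, b[.
  by rewrite /= !in_itv/= => /andP[]; move: (e_gt0 n); lra.
have nD : {homo D : n m / (n <= m)%N >-> (n <= m)%O}.
  move=> n m nm; apply/subsetPset => x; rewrite /D/= !in_itv/=.
  have : e m <= e n.
    by rewrite /e ler_wpM2l ?(ltW ba)// lef_pV2 ?posrE ?ltr0n// ler_nat.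
  by lra.
have mf := measurable_fun_itvoo_continuous cf.
have mfD n : measurable_fun (D n) (EFin \o f).
  by apply/measurable_EFinP; apply: measurable_funS mf => // x /sD.
have fD n x : D n x -> (0 <= (f x)%:E)%E.
  by move=> /sD xab; rewrite lee_fin f0.
have mD n : measurable (D n) by exact: measurable_itv.
have cvI : (\int[mu]_(x in D n) (f x)%:E @[n --> \oo]
    --> \int[mu]_(x in \bigcup_n D n) (f x)%:E)%E.
  exact: ge0_nondecreasing_set_cvg_integral.
rewrite -De in cvI.
have I n : (\int[mu]_(x in D n) (f x)%:E = (F (b - e n) - F (a + e n))%:E)%E.
  apply: (@continuous_FTC2 _ f F) => //.
  - by apply: continuous_in_subspaceT => x; rewrite inE => /sD/cf.
  - split.
    + by move=> x /subset_itv_oo_cc /sD/dF ?; exact: ex_derive.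
    + by apply: cvg_at_right_filter; exact: cF.
    + by apply: cvg_at_left_filter; exact: cF.
  - move=> x /subset_itv_oo_cc /sD/dF ?.
    by rewrite derive1E derive_val.
rewrite (eq_cvg _ _ I) in cvI.
have e0 : e n @[n --> \oo] --> (0 : R).
  rewrite -[X in _ --> X](mulr0 (b - a)); apply: cvgMr.
  have /= := @cvg_harmonic R; rewrite -(cvg_shiftn 2) => H.
  by apply: cvg_trans H; apply: near_eq_cvg; near=> n; rewrite /= addn2.
have cvF : ((F (b - e n) - F (a + e n))%:E @[n --> \oo] --> (F b - F a)%:E)%E.
  apply: cvg_EFin; first by near=> n.
  apply: cvgB.
    apply: continuous_cvg; first exact: cF.
    by rewrite -[X in _ --> X]subr0; apply: cvgB => //; exact: cvg_cst.
  apply: continuous_cvg; first exact: cF.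
  by rewrite -[X in _ --> X]addr0; apply: cvgD => //; exact: cvg_cst.
by apply: (cvg_unique _ cvI cvF).
Unshelve. all: by end_near. Qed.

Lemma ge0_integrable_itvoo_derive f F a b : a < b -> continuous F ->
  {in `]a, b[, continuous f} ->
  {in `]a, b[, forall x : R, is_derive x 1 F (f x)} ->
  {in `]a, b[, forall x, 0 <= f x} ->
  mu.-integrable `]a, b[ (EFin \o f).
Proof.
move=> ab cF cf dF f0; apply/integrableP; split.
  by apply/measurable_EFinP; exact: measurable_fun_itvoo_continuous.
have -> : (\int[mu]_(x in `]a, b[) `|(EFin \o f) x| =
    \int[mu]_(x in `]a, b[) (f x)%:E)%E.
  by apply: eq_integral => x; rewrite inE/= => /f0 fx; rewrite ger0_norm.
by rewrite (ge0_continuous_FTC2_itvoo ab cF cf dF f0) ltry.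
Qed.

Lemma le_integrable_itvoo f g a b : {in `]a, b[, continuous f} ->
  mu.-integrable `]a, b[ (EFin \o g) ->
  {in `]a, b[, forall x, `|f x| <= g x} ->
  mu.-integrable `]a, b[ (EFin \o f).
Proof.
move=> cf ig fg; apply: le_integrable ig => //.
  by apply/measurable_EFinP; exact: measurable_fun_itvoo_continuous.
by move=> x /fg fgx; rewrite /= lee_fin (le_trans fgx)// ler_norm.
Qed.

(** Since [|f| <= g], both [g] and [f + g] are nonnegative with continuous primitives; the
    nonnegative case applies to each, and the two results are subtracted. *)
Lemma dominated_continuous_FTC2_itvoo f g F G a b : a < b ->
  continuous F -> continuous G ->
  {in `]a, b[, continuous f} -> {in `]a, b[, continuous g} ->
  {in `]a, b[, forall x : R, is_derive x 1 F (f x)} ->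
  {in `]a, b[, forall x : R, is_derive x 1 G (g x)} ->
  {in `]a, b[, forall x, `|f x| <= g x} ->
  \int[mu]_(x in `]a, b[) f x = F b - F a.
Proof.
move=> ab cF cG cf cg dF dG fg.
have g0 : {in `]a, b[, forall x, 0 <= g x}.
  by move=> x /fg; apply: le_trans.
have ig := ge0_integrable_itvoo_derive ab cG cg dG g0.
have if_ := le_integrable_itvoo cf ig fg.
have Ig : \int[mu]_(x in `]a, b[) g x = G b - G a.
  by rewrite /Rintegral (ge0_continuous_FTC2_itvoo ab cG cg dG g0).
have Ifg : \int[mu]_(x in `]a, b[) (f x + g x) = (F b + G b) - (F a + G a).
  rewrite /Rintegral (@ge0_continuous_FTC2_itvoo (f \+ g) (F \+ G))//.
  - by move=> x; apply: cvgD; [exact: cF|exact: cG].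
  - by move=> x xab; apply: cvgD; [exact: cf|exact: cg].
  - by move=> x xab; move: (dF x xab) (dG x xab) => ? ?; exact: is_deriveD.
  - by move=> x xab /=; move: (fg x xab); rewrite ler_norml => /andP[]; lra.
move: Ifg; rewrite RintegralD// Ig.
by move: (\int[mu]_(x in _) f x) => I; clear; lra.
Qed.

End ImproperFTC.

(** * Pointwise identities and derivatives for [Pi_poly], Chebyshev polynomials and the semicircle
    root *)

Section SemicirclePolynomials.
Variables (R : realType) (k : R).
Implicit Types (y : R) (n t : nat).
Notation K := (k ^+ 2).

Lemma Pi_poly_rec t y : (Pi_poly K t.+2).[y] =
  (1 + K - y) * (Pi_poly K t.+1).[y] - K * (Pi_poly K t).[y].
Proof. by rewrite /= !hornerE. Qed.

(* [k^n U_n ((1 + k^2 - y) / (2 k))], respectively [2 k^n T_n] at that point. *)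
Fixpoint chebU n y : R :=
  match n with
  | 0 => 1
  | 1 => 1 + K - y
  | (m.+1 as l).+1 => (1 + K - y) * chebU l y - K * chebU m y
  end.

Fixpoint chebT n y : R :=
  match n with
  | 0 => 2
  | 1 => 1 + K - y
  | (m.+1 as l).+1 => (1 + K - y) * chebT l y - K * chebT m y
  end.

Arguments chebU : simpl never.
Arguments chebT : simpl never.

(** The radicand factors as [((1 + k)^2 - y) (y - (1 - k)^2)], so for [k >= 0] this is the numerator
    of the Marchenko-Pastur density with parameter [k^2]. With [1 + K - y = 2 k cos th] it equals
    [2 k sin th]. *)
Definition semicircle y : R := Num.sqrt (4 * K - (1 + K - y) ^+ 2).
Notation w := semicircle.

Lemma chebUSS n y :
  chebU n.+2 y = (1 + K - y) * chebU n.+1 y - K * chebU n y.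
Proof. by []. Qed.

Lemma chebTSS n y :
  chebT n.+2 y = (1 + K - y) * chebT n.+1 y - K * chebT n y.
Proof. by []. Qed.

(** Both sides satisfy the same second-order recurrence, hence an induction carrying two consecutive
    indices. *)
Lemma Pi_polyB t y :
  (Pi_poly K t.+1).[y] - (Pi_poly K t).[y] = - (y * chebU t y).
Proof.
suff : (Pi_poly K t.+1).[y] - (Pi_poly K t).[y] = - (y * chebU t y) /\
  (Pi_poly K t.+2).[y] - (Pi_poly K t.+1).[y] = - (y * chebU t.+1 y) by case.
elim: t => [|t [IH0 IH1]]; first by rewrite /chebU /= !hornerE; split; ring.
split => //; rewrite [in LHS]Pi_poly_rec chebUSS.
have -> : y * ((1 + K - y) * chebU t.+1 y - K * chebU t y) =
  (1 + K - y) * (y * chebU t.+1 y) - K * (y * chebU t y) by ring.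
have -> : y * chebU t y = - ((Pi_poly K t.+1).[y] - (Pi_poly K t).[y]).
  by rewrite IH0 opprK.
have -> : y * chebU t.+1 y = - ((Pi_poly K t.+2).[y] - (Pi_poly K t.+1).[y]).
  by rewrite IH1 opprK.
by rewrite Pi_poly_rec; ring.
Qed.

(* Q(p_{t+1}, p_t) with Q(u, v) = u^2 - (1+K-y) u v + K v^2 gets multiplied by
   K at each step of the recurrence. *)
Lemma Pi_poly_energy t y :
  (Pi_poly K t.+1).[y] ^+ 2
    - (1 + K - y) * (Pi_poly K t.+1).[y] * (Pi_poly K t).[y]
    + K * (Pi_poly K t).[y] ^+ 2 = K ^+ t.+1 * y.
Proof.
elim: t => [|t IH]; first by rewrite /= !hornerE /=; ring.
by rewrite [K ^+ t.+2]exprS -[RHS]mulrA -IH Pi_poly_rec; ring.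
Qed.

(** Completing the square in the invariant, with [v = Pi_t] and [u = Pi_{t+1}]: [4 K^(t+1) y = (2 u
    - (1 + K - y) v)^2 + v^2 w^2], whence [v^2 w^2 <= 4 K^(t+1) y]. *)
Lemma Pi_poly_semicircle_bound t y : 0 <= k -> 0 < y ->
  0 <= 4 * K - (1 + K - y) ^+ 2 ->
  `|(Pi_poly K t).[y] * (w y / y)| <= k ^+ t.+1 * (2 / Num.sqrt y).
Proof.
move=> k0 y0 q0.
have sy0 : 0 < Num.sqrt y by rewrite sqrtr_gt0.
have sy2 : Num.sqrt y ^+ 2 = y by rewrite sqr_sqrtr// ltW.
have main : `|(Pi_poly K t).[y] * w y| <= 2 * k ^+ t.+1 * Num.sqrt y.
  rewrite -ler_sqr ?nnegrE ?mulr_ge0 ?exprn_ge0 ?(ltW sy0)//.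
  rewrite real_normK ?num_real// !exprMn sy2 sqr_sqrtr// exprAC.
  have := Pi_poly_energy t y.
  set u := (Pi_poly K t.+1).[y]; set v := (Pi_poly K t).[y] => E.
  have -> : 2 ^+ 2 * K ^+ t.+1 * y = 4 * (K ^+ t.+1 * y) by ring.
  rewrite -E -subr_ge0.
  have -> : 4 * (u ^+ 2 - (1 + K - y) * u * v + K * v ^+ 2)
    - v ^+ 2 * (4 * K - (1 + K - y) ^+ 2)
    = (2 * u - (1 + K - y) * v) ^+ 2 by ring.
  exact: sqr_ge0.
rewrite mulrA normrM normfV (gtr0_norm y0) ler_pdivrMr//.
apply: le_trans main _.
rewrite -{3}sy2 le_eqVlt; apply/orP; left; apply/eqP.
by field; rewrite gt_eqF.
Qed.

(** With [1 + K - y = 2 k cos th] this reads [sin th sin (n+1)th = cos n th - cos th cos (n+1)th];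
    as a polynomial identity it follows from the recurrences alone. *)
Lemma semicircle_chebU n y : (4 * K - (1 + K - y) ^+ 2) * chebU n y =
  2 * K * chebT n y - (1 + K - y) * chebT n.+1 y.
Proof.
suff : (4 * K - (1 + K - y) ^+ 2) * chebU n y =
  2 * K * chebT n y - (1 + K - y) * chebT n.+1 y /\
  (4 * K - (1 + K - y) ^+ 2) * chebU n.+1 y =
  2 * K * chebT n.+1 y - (1 + K - y) * chebT n.+2 y by case.
elim: n => [|n [IH0 IH1]]; first by rewrite /chebU /chebT; split; ring.
split => //; rewrite chebUSS.
set q := 4 * K - _ in IH0 IH1 *.
have -> : q * ((1 + K - y) * chebU n.+1 y - K * chebU n y) =
  (1 + K - y) * (q * chebU n.+1 y) - K * (q * chebU n y) by ring.
by rewrite IH0 IH1 (chebTSS n.+1) (chebTSS n); ring.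
Qed.

Lemma semicircle_continuous : continuous w.
Proof.
move=> y; apply: (@continuous_comp _ _ _ (fun y => 4 * K - (1 + K - y) ^+ 2));
  last exact: sqrt_continuous.
apply: cvgB; first exact: cvg_cst.
apply: (@continuous_comp _ _ _ (fun y => 1 + K - y) (fun z => z ^+ 2)).
  by apply: cvgB; [exact: cvg_cst|exact: cvg_id].
exact: exprn_continuous.
Qed.

Lemma is_derive_semicircle y : 0 < 4 * K - (1 + K - y) ^+ 2 ->
  is_derive y 1 w ((1 + K - y) / w y).
Proof.
move=> q0.
have H : is_derive y 1 (fun y => 4 * K - (1 + K - y) ^+ 2) (2 * (1 + K - y)).
  by apply: is_derive_eq; rewrite /GRing.scale/=; ring.
have := @is_derive1_comp _ _ (fun y => 4 * K - (1 + K - y) ^+ 2) _ _ _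
  (is_derive1_sqrt q0) H.
move=> H'; apply: (is_derive_eq H').
by rewrite /w; field; rewrite gt_eqF// sqrtr_gt0.
Qed.

(** In the angle variable [w U_n = 2 k^(n+1) sin (n+1)th] and [dy = w dth], so differentiating
    produces [(n+1) T_{n+1} / w]. *)
Lemma is_derive_semicircle_chebU n y : 0 < 4 * K - (1 + K - y) ^+ 2 ->
  is_derive y 1 (fun z => w z * chebU n z) (n.+1%:R * chebT n.+1 y / w y).
Proof.
move=> q0.
have w0 : 0 < w y by rewrite sqrtr_gt0.
have w2 : w y ^+ 2 = 4 * K - (1 + K - y) ^+ 2 by rewrite sqr_sqrtr// ltW.
have dw := is_derive_semicircle q0.
suff : is_derive y 1 (fun z => w z * chebU n z)
    (n.+1%:R * chebT n.+1 y / w y) /\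
  is_derive y 1 (fun z => w z * chebU n.+1 z) (n.+2%:R * chebT n.+2 y / w y).
  by case.
elim: n => [|n [IH0 IH1]].
  split.
    rewrite (_ : (fun z => _) = w); last by apply/funext => z; rewrite mulr1.
    by rewrite mul1r.
  rewrite (_ : (fun z => _) = (fun z => w z * (1 + K - z)))//.
  apply: is_derive_eq; rewrite /GRing.scale/=.
  rewrite /chebT.
  have -> : 2 * ((1 + K - y) * (1 + K - y) - K * 2) =
    (1 + K - y) ^+ 2 - (4 * K - (1 + K - y) ^+ 2) by ring.
  by rewrite -w2; field; rewrite gt_eqF.
split => //.
have -> : (fun z => w z * chebU n.+2 z) =
    (fun z => (1 + K - z) * (w z * chebU n.+1 z) - K * (w z * chebU n z)).
  by apply/funext => z; rewrite chebUSS; ring.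
apply: is_derive_eq; rewrite /GRing.scale/=.
(* The product rule leaves a term [w U_{n+1}]; this identity rewrites it over the common denominator
   [w] in terms of [chebT]. *)
have := semicircle_chebU n.+1 y; rewrite -w2 => E.
have wU : w y * chebU n.+1 y =
   (2 * K * chebT n.+1 y - (1 + K - y) * chebT n.+2 y) / w y.
  by apply: (mulIf (lt0r_neq0 w0)); rewrite divfK ?lt0r_neq0// -E; ring.
rewrite wU (chebTSS n.+1) -[n.+3%:R]natr1 -[n.+2%:R]natr1 -[n.+1%:R]natr1.
by field; rewrite gt_eqF.
Qed.

(** From [2 sin th sin (n+2)th = cos (n+1)th - cos (n+3)th], integrated termwise. The index starts
    at [n.+1]: for [U_0] a constant term would integrate to the angle itself, which is not
    algebraic. *)
Lemma is_derive_primitive_chebU n y : 0 < 4 * K - (1 + K - y) ^+ 2 ->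
  is_derive y 1 (fun z => K / n.+1%:R * (w z * chebU n z)
                          - n.+3%:R^-1 * (w z * chebU n.+2 z))
    (w y * chebU n.+1 y).
Proof.
move=> q0.
have w0 : 0 < w y by rewrite sqrtr_gt0.
have w2 : w y ^+ 2 = 4 * K - (1 + K - y) ^+ 2 by rewrite sqr_sqrtr// ltW.
have d0 := is_derive_semicircle_chebU n q0.
have d2 := is_derive_semicircle_chebU n.+2 q0.
apply: is_derive_eq; rewrite /GRing.scale/=.
have := semicircle_chebU n.+1 y; rewrite -w2 => E.
have wU : w y * chebU n.+1 y =
   (2 * K * chebT n.+1 y - (1 + K - y) * chebT n.+2 y) / w y.
  by apply: (mulIf (lt0r_neq0 w0)); rewrite divfK ?lt0r_neq0// -E; ring.
rewrite wU (chebTSS n.+1); field.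
by have n0 := ler0n R n; rewrite (gt_eqF w0) !gt_eqF//; lra.
Qed.

Lemma chebU_continuous n : continuous (chebU n).
Proof.
suff : continuous (chebU n) /\ continuous (chebU n.+1) by case.
have c1 : continuous (fun y => 1 + K - y).
  by move=> y; apply: cvgB; [exact: cvg_cst|exact: cvg_id].
elim: n => [|n [IH0 IH1]]; first by rewrite /chebU; split => //= y;
  exact: cvg_cst.
rewrite (_ : chebU n.+2 =
  (fun y => (1 + K - y) * chebU n.+1 y - K * chebU n y))//.
split => // y; apply: cvgB; apply: cvgM.
- exact: c1.
- exact: IH1.
- exact: cvg_cst.
- exact: IH0.
Qed.

End SemicirclePolynomials.

(** * Orthogonality of [Pi_poly] on an interval mapped affinely onto the support of the kernel *)

Section PiOrthogonality.
Variables (R : realType) (k om c a b : R).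
Hypotheses (k_gt0 : 0 < k) (k_le1 : k <= 1) (om_gt0 : 0 < om).
Hypotheses (ha : om * (a - c) = (1 - k) ^+ 2)
  (hb : om * (b - c) = (1 + k) ^+ 2).
Notation mu := (@lebesgue_measure R).
Notation K := (k ^+ 2).
Notation w := (semicircle k).
Notation Y x := (om * (x - c)).

(** Up to the factor [2 pi k^2], the Marchenko-Pastur density with parameter [k^2] at [Y x].
    Integrals stay in the variable [x], so that only the chain rule is needed and no change of
    variables. *)
Definition mp_kernel (x : R) : R := w (Y x) / Y x.

Definition mp_form (p : {poly R}) : R :=
  \int[mu]_(x in `]a, b[) (p.[Y x] * mp_kernel x).

Lemma affine_itv x : x \in `]a, b[ -> (1 - k) ^+ 2 < Y x < (1 + k) ^+ 2.
Proof.
by rewrite in_itv/= -ha -hb !ltr_pM2l// !ltrD2r.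
Qed.

Lemma affine_gt0 x : x \in `]a, b[ -> 0 < Y x.
Proof. by move=> /affine_itv/andP[+ _]; apply: le_lt_trans; exact: sqr_ge0. Qed.

Lemma semicircle_radicand_gt0 x : x \in `]a, b[ ->
  0 < 4 * K - (1 + K - Y x) ^+ 2.
Proof.
move=> /affine_itv/andP[]; rewrite -subr_gt0 => l; rewrite -subr_gt0 => r.
have -> : 4 * K - (1 + K - Y x) ^+ 2
  = (Y x - (1 - k) ^+ 2) * ((1 + k) ^+ 2 - Y x) by ring.
exact: mulr_gt0.
Qed.

Lemma support_lt : a < b.
Proof.
rewrite -subr_gt0 -(pmulr_rgt0 _ om_gt0).
have -> : om * (b - a) = om * (b - c) - om * (a - c) by ring.
rewrite ha hb; have -> : (1 + k) ^+ 2 - (1 - k) ^+ 2 = 4 * k by ring.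
by rewrite mulr_gt0.
Qed.

Lemma semicircle_support_l : w (Y a) = 0.
Proof.
by rewrite /semicircle ha (_ : _ - _ = 0) ?sqrtr0//; ring.
Qed.

Lemma semicircle_support_r : w (Y b) = 0.
Proof.
by rewrite /semicircle hb (_ : _ - _ = 0) ?sqrtr0//; ring.
Qed.

Lemma affine_continuous : continuous (fun x : R => Y x).
Proof.
move=> x; apply: cvgM; first exact: cvg_cst.
by apply: cvgB; [exact: cvg_id|exact: cvg_cst].
Qed.

Lemma is_derive_comp_affine (F : R -> R) (d x : R) :
  is_derive (Y x) 1 F d -> is_derive x 1 (fun x => F (Y x)) (om * d).
Proof.
move=> dF.
have dY : is_derive x 1 (fun x => Y x) om.
  by apply: is_derive_eq; rewrite /GRing.scale/=; ring.
have := @is_derive1_comp _ F (fun x => Y x) _ _ _ dF dY => H.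
by apply: (is_derive_eq H); rewrite mulrC.
Qed.

Lemma continuous_comp_affine (F : R -> R) : continuous F ->
  continuous (fun x => F (Y x)).
Proof.
move=> cF x; apply: (continuous_comp (affine_continuous (x := x))).
exact: cF.
Qed.

Lemma mp_kernel_continuous (p : {poly R}) :
  {in `]a, b[, continuous (fun x => p.[Y x] * mp_kernel x)}.
Proof.
move=> x /affine_gt0 y0; apply: cvgM.
  exact: (continuous_comp_affine (@continuous_horner _ p)).
apply: cvgM; first exact: (continuous_comp_affine (@semicircle_continuous _ k)).
by apply: cvgV; [rewrite gt_eqF|exact: affine_continuous].
Qed.

(** Dominating function from [Pi_poly_semicircle_bound]. Its primitive [G] is continuous even where
    [Y] vanishes, so [g] stays integrable when [k = 1] and [Y a = 0]. *)
Let g (x : R) : R := 2 / Num.sqrt (Y x).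
Let G (x : R) : R := 4 / om * Num.sqrt (Y x).

Let G_continuous : continuous G.
Proof.
move=> x; apply: cvgM; first exact: cvg_cst.
exact: (continuous_comp_affine (@sqrt_continuous R)).
Qed.

Let g_continuous : {in `]a, b[, continuous g}.
Proof.
move=> x /affine_gt0 y0; apply: cvgM; first exact: cvg_cst.
apply: cvgV; first by rewrite gt_eqF// sqrtr_gt0.
exact: (continuous_comp_affine (@sqrt_continuous R)).
Qed.

Let g_derive : {in `]a, b[, forall x : R, is_derive x 1 G (g x)}.
Proof.
move=> x /affine_gt0 y0.
have dS := is_derive_comp_affine (is_derive1_sqrt y0).
apply: is_derive_eq; rewrite /GRing.scale/= /g; field.
by rewrite !gt_eqF// sqrtr_gt0.
Qed.

Let g_ge0 : {in `]a, b[, forall x, 0 <= g x}.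
Proof. by move=> x _; rewrite /g divr_ge0// sqrtr_ge0. Qed.

Let g_integrable : mu.-integrable `]a, b[ (EFin \o g).
Proof.
exact: (ge0_integrable_itvoo_derive support_lt G_continuous g_continuous
  g_derive g_ge0).
Qed.

Let Pi_kernel_bound t : {in `]a, b[, forall x,
  `|(Pi_poly K t).[Y x] * mp_kernel x| <= k ^+ t.+1 * g x}.
Proof.
move=> x xab; apply: Pi_poly_semicircle_bound; first exact: ltW.
  exact: affine_gt0.
by apply: ltW; exact: semicircle_radicand_gt0.
Qed.

Let Pi_kernel_bound1 t : {in `]a, b[, forall x,
  `|(Pi_poly K t).[Y x] * mp_kernel x| <= g x}.
Proof.
move=> x xab; apply: le_trans (Pi_kernel_bound t xab) _.
by rewrite ler_piMl// ?g_ge0// exprn_ile1// ltW.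
Qed.

Lemma mp_integrable (p : {poly R}) :
  mu.-integrable `]a, b[ (EFin \o (fun x => p.[Y x] * mp_kernel x)).
Proof.
(* [Y] takes values in [[0, 4]] on the interval because [(1 + k)^2 <= 4]; the kernel itself is
   bounded by [g], the case [t = 0] of the bound on the [Pi_t]. *)
have [C HC] := poly_itv_bound p 0 4.
have iCg : mu.-integrable `]a, b[ (EFin \o (fun x => C * g x)).
  exact: integrableZl g_integrable.
apply: le_integrable_itvoo iCg _; first exact: mp_kernel_continuous.
move=> x xab; rewrite normrM; apply: ler_pM => //.
  apply: HC; rewrite ltW ?affine_gt0//=.
  have /andP[_ /ltW/le_trans] := affine_itv xab; apply.
  have : k ^+ 2 <= 1 by rewrite exprn_ile1 ?(ltW k_gt0).
  move=> k2; rewrite (_ : (1 + k) ^+ 2 = 1 + 2 * k + k ^+ 2); last by ring.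
  by move: k_le1 k2; lra.
by have := Pi_kernel_bound1 0 xab; rewrite hornerC mul1r.
Qed.

Lemma mp_formB p q : mp_form (p - q) = mp_form p - mp_form q.
Proof.
rewrite -RintegralB//; [|exact: mp_integrable..].
by apply: eq_Rintegral => x _; rewrite hornerD hornerN mulrBl.
Qed.

Lemma mp_formZ u p : mp_form (u *: p) = u * mp_form p.
Proof.
rewrite -RintegralZl//; last exact: mp_integrable.
by apply: eq_Rintegral => x _; rewrite hornerZ -mulrA.
Qed.

Lemma mp_form_Pi_const t : mp_form (Pi_poly K t.+2) = mp_form (Pi_poly K t.+1).
Proof.
apply/eqP; rewrite -subr_eq0 -mp_formB; apply/eqP.
(* [Pi_{t+2} - Pi_{t+1} = - y U_{t+1}] cancels the denominator of the kernel; [om^-1] compensates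
   the chain rule. [F] vanishes at both ends along with [w]. *)
pose F z := - om^-1 * (K / t.+1%:R * (w z * chebU k t z)
                       - t.+3%:R^-1 * (w z * chebU k t.+2 z)).
have cF : continuous F.
  move=> z; apply: cvgM; first exact: cvg_cst.
  by apply: cvgB; apply: cvgM; (try exact: cvg_cst); apply: cvgM;
    first [exact: semicircle_continuous|exact: chebU_continuous].
set p := _ - _.
have -> : mp_form p = F (Y b) - F (Y a); last first.
  by rewrite /F semicircle_support_l semicircle_support_r; ring.
apply: (@dominated_continuous_FTC2_itvoo _ (fun x => p.[Y x] * mp_kernel x)
  (fun x => 2 * g x) (fun x => F (Y x)) (fun x => 2 * G x)).
- exact: support_lt.
- exact: (continuous_comp_affine cF).
- by move=> x; apply: cvgM; [exact: cvg_cst|exact: G_continuous].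
- exact: mp_kernel_continuous.
- by move=> x xab; apply: cvgM; [exact: cvg_cst|exact: g_continuous].
- move=> x xab.
  have y0 := affine_gt0 xab.
  have dP := is_derive_primitive_chebU t (semicircle_radicand_gt0 xab).
  have dF : is_derive (Y x) 1 F (- om^-1 * (w (Y x) * chebU k t.+1 (Y x))).
    by apply: is_derive_eq.
  apply: (is_derive_eq (is_derive_comp_affine dF)).
  rewrite /p hornerD hornerN Pi_polyB /mp_kernel.
  move: (om * (x - c)) y0 => y y0; field.
  by rewrite !gt_eqF.
- move=> x xab; have dG := g_derive xab.
  by apply: is_derive_eq; rewrite /GRing.scale/=; ring.
- move=> x xab; rewrite /p hornerD hornerN mulrBl.
  apply: (le_trans (ler_normB _ _)); rewrite mulr_natl mulr2n.
  by apply: lerD; exact: Pi_kernel_bound1.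
Qed.

Lemma mp_form_Pi1 t : mp_form (Pi_poly K t.+1) = mp_form (Pi_poly K 1).
Proof. by elim: t => // t IH; rewrite mp_form_Pi_const. Qed.

Lemma mp_form_Pi1_eq0_lt1 : k < 1 -> mp_form (Pi_poly K 1) = 0.
Proof.
move=> k_lt1.
pose M := \int[mu]_(x in `]a, b[) g x.
(* The left side does not depend on [t]: it also equals the integral for [Pi_{t+1}], whose pointwise
   bound carries [k^(t+2)]. *)
have bnd t : `|mp_form (Pi_poly K 1)| <= k ^+ t * (k ^+ 2 * M).
  rewrite -(mp_form_Pi1 t) mulrA -exprD addn2.
  rewrite -RintegralZl//.
  apply: le_trans (le_normr_Rintegral _ _) _ => //; first exact: mp_integrable.
  apply: le_Rintegral => //.
  - exact: integrable_norm (mp_integrable _).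
  - exact: integrableZl g_integrable.
  - by move=> x xab; exact: Pi_kernel_bound.
have cv : k ^+ t * (k ^+ 2 * M) @[t --> \oo] --> (0 : R).
  rewrite -[X in _ --> X](mul0r (k ^+ 2 * M)); apply: cvgM; last exact: cvg_cst.
  by apply: cvg_expr; rewrite gtr0_norm.
apply/eqP; rewrite -normr_le0.
rewrite -(cvg_lim _ cv)//.
apply: limr_ge; first by apply/cvg_ex; eexists; exact: cv.
by near=> t.
Unshelve. all: by end_near. Qed.

Lemma mp_form_Pi1_eq0_eq1 : k = 1 -> mp_form (Pi_poly K 1) = 0.
Proof.
move=> k1.
(* For [k = 1], [w^2 = y (4 - y)], so [(w (4 - y) / 2)' = (4 - y) (1 - y) / w = (1 - y) w / y]. *)
pose F z := (2 * om)^-1 * (w z * (4 - z)).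
have cF : continuous F.
  move=> z; apply: cvgM; first exact: cvg_cst.
  apply: cvgM; first exact: semicircle_continuous.
  by apply: cvgB; [exact: cvg_cst|exact: cvg_id].
have -> : mp_form (Pi_poly K 1) = F (Y b) - F (Y a); last first.
  by rewrite /F semicircle_support_l semicircle_support_r; ring.
apply: (@dominated_continuous_FTC2_itvoo _
  (fun x => (Pi_poly K 1).[Y x] * mp_kernel x) g (fun x => F (Y x)) G) => //.
- exact: support_lt.
- exact: (continuous_comp_affine cF).
- exact: mp_kernel_continuous.
- move=> x xab.
  have y0 := affine_gt0 xab; have q0 := semicircle_radicand_gt0 xab.
  have dw := is_derive_semicircle q0.
  have dF : is_derive (Y x) 1 F
     ((2 * om)^-1 * ((1 + K - Y x) / w (Y x) * (4 - Y x) - w (Y x))).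
    by apply: is_derive_eq; rewrite /GRing.scale/=; ring.
  apply: (is_derive_eq (is_derive_comp_affine dF)).
  have w0 : 0 < w (Y x) by rewrite sqrtr_gt0.
  have w2 : w (Y x) ^+ 2 = Y x * (4 - Y x).
    by rewrite sqr_sqrtr ?(ltW q0)// k1; ring.
  rewrite /mp_kernel (_ : (Pi_poly K 1).[_] = 1 - Y x); last first.
    by rewrite /= !hornerE.
  move: (Y x) y0 (w (Y x)) w0 w2 => y y0 u u0 u2; rewrite k1.
  have -> : u / y = (4 - y) / u.
    by apply/eqP; rewrite eqr_div ?lt0r_neq0// -expr2 u2 mulrC.
  have {2}-> : u = y * (4 - y) / u by rewrite -u2 expr2 mulfK// gt_eqF.
  by field; rewrite !gt_eqF.
Qed.

Lemma mp_form_Pi t : mp_form (Pi_poly K t.+1) = 0.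
Proof.
rewrite mp_form_Pi1; have := k_le1; rewrite le_eqVlt => /predU1P[|].
  exact: mp_form_Pi1_eq0_eq1.
exact: mp_form_Pi1_eq0_lt1.
Qed.

(* Favard's argument: expand the form at 'X * Pi_s * Pi_t with the three-term
   recurrence applied to either factor. *)
Lemma mp_form_PiM_lt s t : (s < t)%N ->
  mp_form (Pi_poly K s * Pi_poly K t) = 0.
Proof.
have X0 : 'X * Pi_poly K 0 = Pi_poly K 0 - Pi_poly K 1 :> {poly R}.
  by rewrite /=; ring.
have XS n : 'X * Pi_poly K n.+1 = (1 + K) *: Pi_poly K n.+1 - Pi_poly K n.+2
    - K *: Pi_poly K n :> {poly R}.
  by rewrite /= -!mul_polyC; ring.
have P0 : Pi_poly K 0 = 1 :> {poly R} by [].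
have HP := mp_form_Pi.
(* The family is made abstract: its recurrence and the vanishing of the form at [P t.+1] are all
   that the argument takes from it. *)
move: (Pi_poly K) P0 X0 XS HP => P P0 X0 XS HP.
suff : forall t, ((s < t)%N -> mp_form (P s * P t) = 0) /\
    ((s.+1 < t)%N -> mp_form (P s.+1 * P t) = 0).
  by move=> /(_ t)[].
elim: s {t} => [|s IH] t.
  have H0 n : mp_form (P 0 * P n.+1) = 0.
    by rewrite P0 mul1r HP.
  split; first by case: t => // t _; exact: H0.
  case: t => [|[|t]]// _.
  have : mp_form ('X * P 0 * P t.+2) =
    mp_form (P 0 * ('X * P t.+2)) by congr mp_form; ring.
  rewrite X0 XS mulrBl !mulrBr -!scalerAr !mp_formB !mp_formZ !H0.
  by rewrite !mulr0 !subr0 sub0r => /eqP; rewrite oppr_eq0 => /eqP.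
split; first by case: (IH t).
case: t => [|t]//; rewrite !ltnS => st.
(* Here [s.+1 < t]. Both expansions contain only products covered by the induction hypothesis,
   except [P s.+2 * P t.+1], whose form must therefore vanish. *)
have : mp_form ('X * P s.+1 * P t.+1) =
  mp_form (P s.+1 * ('X * P t.+1)) by congr mp_form; ring.
rewrite !XS !mulrBl !mulrBr -!scalerAr -!scalerAl !mp_formB !mp_formZ.
rewrite (IH t.+1).2 1?ltnW// (IH t.+2).2 1?ltnW// 1?ltnW// (IH t).2//.
rewrite (IH t.+1).1; last by rewrite ltnW// ltnW.
by rewrite !mulr0 !subr0 sub0r => /eqP; rewrite oppr_eq0 => /eqP.
Qed.

Lemma mp_form_PiM s t : s <> t -> mp_form (Pi_poly K s * Pi_poly K t) = 0.
Proof.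
move=> /eqP; rewrite neq_ltn => /orP[]; first exact: mp_form_PiM_lt.
by move=> ts; rewrite mulrC; exact: mp_form_PiM_lt.
Qed.

End PiOrthogonality.

(** The endpoints form a null set, so the values there, including those given by division by zero,
    are harmless. *)
Lemma integrable_itvoo_itvcc (R : realType) (f : R -> R) (a b : R) :
  lebesgue_measure.-integrable `]a, b[ (EFin \o f) ->
  lebesgue_measure.-integrable `[a, b] (EFin \o f).
Proof.
move=> /integrableP[mf fi]; apply/integrableP; split.
  by move/measurable_EFinP : mf => /measurable_fun_itv_cc/measurable_EFinP.
by rewrite integral_itv_bndoo//; exact: measurableT_comp.
Qed.

(** * Degree of [Pi_poly] and its positivity to the left of the support *)

Section PiPolyAlgebra.
Variables (R : realType) (K : R).

Lemma size_Pi_poly t : size (Pi_poly K t) = t.+1.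
Proof.
suff : size (Pi_poly K t) = t.+1 /\ size (Pi_poly K t.+1) = t.+2 by case.
have sX u : size (u%:P - 'X : {poly R}) = 2.
  by rewrite -opprB size_polyN size_XsubC.
elim: t => [|t [IH0 IH1]]; first by rewrite size_poly1 /= sX.
split => //.
have P0 : Pi_poly K t.+1 != 0 by rewrite -size_poly_eq0 IH1.
have C0 : (1 + K)%:P - 'X != 0 :> {poly R} by rewrite -size_poly_eq0 sX.
have -> : Pi_poly K t.+2 = ((1 + K)%:P - 'X) * Pi_poly K t.+1
  - K *: Pi_poly K t by rewrite -mul_polyC.
have sM : size (((1 + K)%:P - 'X) * Pi_poly K t.+1) = t.+3.
  by rewrite size_mul// sX IH1.
rewrite size_polyDl sM// size_polyN.
by rewrite (leq_ltn_trans (size_scale_leq _ _))// IH0.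
Qed.

(** The values increase with [t], since [P_{t+2} - P_{t+1} = K (P_{t+1} - P_t) - y P_{t+1}]. This
    makes the normalising constant of [R_poly] nonzero. *)
Lemma Pi_poly_ge1 t (y : R) : 0 <= K -> y <= 0 -> 1 <= (Pi_poly K t).[y].
Proof.
move=> K0 y0.
suff : 1 <= (Pi_poly K t).[y] <= (Pi_poly K t.+1).[y] by case/andP.
elim: t => [|t /andP[IH0 IH1]]; first by rewrite /= !hornerE lexx/=; lra.
rewrite (le_trans IH0 IH1)/=.
have -> : (Pi_poly K t.+2).[y] =
  (1 + K - y) * (Pi_poly K t.+1).[y] - K * (Pi_poly K t).[y].
  by rewrite /= !hornerE.
by nra.
Qed.

End PiPolyAlgebra.

(** * Parameter computations linking [R_poly] and [weight] to the affine setting *)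

Section RescaledFamily.
Variables (R : realType) (g xi : R).
Hypotheses (hg0 : 0 < g) (hg1 : g < 1) (hxi0 : g < xi) (hxi1 : xi < 1).
Let p := Num.sqrt ((1 - g) * xi).
Let q := Num.sqrt ((1 - xi) * g).

Let xi_gt0 : 0 < xi. Proof. exact: lt_trans hxi0. Qed.
Let onem_g_gt0 : 0 < 1 - g. Proof. by rewrite subr_gt0. Qed.
Let onem_xi_gt0 : 0 < 1 - xi. Proof. by rewrite subr_gt0. Qed.

Let p2 : p ^+ 2 = (1 - g) * xi.
Proof. by rewrite sqr_sqrtr// mulr_ge0// ltW. Qed.
Let q2 : q ^+ 2 = (1 - xi) * g.
Proof. by rewrite sqr_sqrtr// mulr_ge0// ltW. Qed.
Let q_gt0 : 0 < q. Proof. by rewrite sqrtr_gt0 mulr_gt0. Qed.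
Let q_lt_p : q < p.
Proof. by rewrite ltr_sqrt ?mulr_gt0//; move: hxi0; lra. Qed.

(** The four products of [g] or [1 - g] with [xi] or [1 - xi] sum to 1, and [2 p q] is at most the
    sum of the two absent from [p^2 + q^2], by the arithmetic-geometric mean inequality. Equality
    means [xi = 1 - g]. *)
Let pq_le1 : p + q <= 1.
Proof.
have p0 : 0 < p by exact: lt_trans q_lt_p.
have h : 2 * (p * q) <= (1 - g) * (1 - xi) + g * xi.
  rewrite -ler_sqr ?nnegrE; last 2 first.
  - by rewrite !mulr_ge0// ltW.
  - by rewrite addr_ge0// mulr_ge0// ltW.
  rewrite !exprMn p2 q2 -subr_ge0.
  have -> : ((1 - g) * (1 - xi) + g * xi) ^+ 2
      - 2 ^+ 2 * ((1 - g) * xi * ((1 - xi) * g))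
    = ((1 - g) * (1 - xi) - g * xi) ^+ 2 by ring.
  exact: sqr_ge0.
rewrite -ler_sqr ?nnegrE ?addr_ge0 ?(ltW p0) ?(ltW q_gt0)// expr1n.
have -> : (p + q) ^+ 2 = p ^+ 2 + q ^+ 2 + 2 * (p * q) by ring.
by rewrite p2 q2; move: h; lra.
Qed.

Let p_gt0 : 0 < p. Proof. exact: lt_trans q_lt_p. Qed.

Let sqrt_Lam : Num.sqrt (Lam_h g xi) = p + q.
Proof. by rewrite sqrtr_sqr ger0_norm// addr_ge0// ltW. Qed.

Let sqrt_lam : Num.sqrt (lam_h g xi) = p - q.
Proof. by rewrite sqrtr_sqr ger0_norm// subr_ge0 ltW. Qed.

Lemma sqrt_tau_p : Num.sqrt (tau_p g xi) = q / p.
Proof.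
rewrite /tau_p sqrt_Lam sqrt_lam sqrtr_sqr.
have -> : (p + q - (p - q)) / (p + q + (p - q)) = q / p.
  by field; rewrite !gt_eqF//; move: p_gt0; lra.
by rewrite ger0_norm// divr_ge0// ltW.
Qed.

(** [c] is the square of the harmonic mean of [p + q] and [p - q]. *)
Lemma c_pE : c_p g xi = ((p ^+ 2 - q ^+ 2) / p) ^+ 2.
Proof.
rewrite /c_p !div1r !sqrtrV ?sqr_ge0// sqrt_Lam sqrt_lam.
field; rewrite !gt_eqF//; move: p_gt0 q_gt0 q_lt_p => *; lra.
Qed.

Lemma c_p_ge0 : 0 <= c_p g xi. Proof. by rewrite c_pE sqr_ge0. Qed.

Lemma c_p_le_alpha : c_p g xi <= alpha_p g xi.
Proof.
rewrite c_pE /alpha_p sqrt_tau_p -subr_ge0.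
have -> : (1 - q / p) ^+ 2 - ((p ^+ 2 - q ^+ 2) / p) ^+ 2
  = ((p - q) / p) ^+ 2 * (1 - (p + q) ^+ 2) by field; rewrite gt_eqF.
by rewrite mulr_ge0 ?sqr_ge0// subr_ge0 expr_le1// addr_ge0// ltW.
Qed.

Lemma alpha_lt_beta : alpha_p g xi < beta_p g xi.
Proof.
rewrite /alpha_p /beta_p sqrt_tau_p -subr_gt0.
have -> : (1 + q / p) ^+ 2 - (1 - q / p) ^+ 2 = 4 * (q / p) by ring.
by rewrite mulr_gt0// divr_gt0.
Qed.

Let A := Num.sqrt (alpha_p g xi - c_p g xi).
Let B := Num.sqrt (beta_p g xi - c_p g xi).
(** It equals 1 exactly when [A = 0], that is when [c] coincides with [alpha]. *)
Definition sqrt_kappa := (B - A) / (B + A).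

Let A_ge0 : 0 <= A. Proof. exact: sqrtr_ge0. Qed.
Let A_lt_B : A < B.
Proof.
rewrite ltr_sqrt ?ltrD2r ?alpha_lt_beta// subr_gt0.
exact: le_lt_trans c_p_le_alpha alpha_lt_beta.
Qed.
Let AB_gt0 : 0 < B + A.
Proof. by rewrite ltr_pwDl// (le_lt_trans A_ge0 A_lt_B). Qed.

Lemma sqrt_kappa_gt0 : 0 < sqrt_kappa.
Proof. by rewrite divr_gt0// subr_gt0. Qed.

Lemma sqrt_kappa_le1 : sqrt_kappa <= 1.
Proof. by rewrite ler_pdivrMr// mul1r; move: A_ge0; lra. Qed.

Lemma kappa_pE : kappa_p g xi = sqrt_kappa ^+ 2. Proof. by []. Qed.

Lemma omega_p_gt0 : 0 < omega_p g xi.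
Proof. by rewrite divr_gt0// exprn_gt0. Qed.

(** [1 - sqrt_kappa = 2 A / (B + A)], and [omega] is the square of [2 / (B + A)]. *)
Lemma omega_alpha :
  omega_p g xi * (alpha_p g xi - c_p g xi) = (1 - sqrt_kappa) ^+ 2.
Proof.
have A2 : A ^+ 2 = alpha_p g xi - c_p g xi.
  by rewrite sqr_sqrtr// subr_ge0 c_p_le_alpha.
rewrite /omega_p -/A -/B -A2 /sqrt_kappa; field.
by rewrite gt_eqF.
Qed.

Lemma omega_beta :
  omega_p g xi * (beta_p g xi - c_p g xi) = (1 + sqrt_kappa) ^+ 2.
Proof.
have B2 : B ^+ 2 = beta_p g xi - c_p g xi.
  by rewrite sqr_sqrtr// subr_ge0 (le_trans c_p_le_alpha)// ltW// alpha_lt_beta.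
rewrite /omega_p -/A -/B -B2 /sqrt_kappa; field.
by rewrite gt_eqF.
Qed.

Notation om := (omega_p g xi).
Notation c := (c_p g xi).
Notation N t := ((Pi_poly (kappa_p g xi) t).[- (om * c)]).

Lemma R_poly_norm_gt0 t : 0 < N t.
Proof.
apply: lt_le_trans ltr01 _; apply: Pi_poly_ge1; first exact: sqr_ge0.
by rewrite oppr_le0 mulr_ge0 ?c_p_ge0// ltW// omega_p_gt0.
Qed.

Lemma R_polyE t x :
  (R_poly g xi t).[x] = (N t)^-1 * (Pi_poly (kappa_p g xi) t).[om * (x - c)].
Proof. by rewrite hornerZ horner_comp !hornerE. Qed.

Lemma size_R_poly t : size (R_poly g xi t) = t.+1.
Proof.
rewrite size_scale ?invr_eq0 ?gt_eqF ?R_poly_norm_gt0//.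
rewrite size_comp_poly2 ?size_Pi_poly// size_scale ?size_XsubC//.
by rewrite gt_eqF// omega_p_gt0.
Qed.

(** The factor [x] cancels the one in the density. The semicircle root yields a factor [om], which
    cancels the one in [om * (x - c)], so the constant is free of [om]. *)
Lemma weightE x : x \in `]alpha_p g xi, beta_p g xi[ ->
  weight g xi x = (2 * pi * tau_p g xi)^-1 * mp_kernel sqrt_kappa om c x.
Proof.
move=> xab; have om0 := omega_p_gt0.
have y0 := affine_gt0 om0 omega_alpha omega_beta xab.
move: xab; rewrite in_itv/= => /andP[ax xb].
have x0 : 0 < x by apply: le_lt_trans ax; exact: sqr_ge0.
have xc : 0 < x - c by rewrite subr_gt0; exact: le_lt_trans c_p_le_alpha ax.
have t0 : 0 < tau_p g xi by rewrite -sqrtr_gt0 sqrt_tau_p divr_gt0.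
rewrite /weight /mp_density -/(alpha_p g xi) -/(beta_p g xi) /pos_part.
rewrite !max_l ?subr_ge0 ?(ltW ax) ?(ltW xb)//.
rewrite /mp_kernel /semicircle.
have -> : 4 * sqrt_kappa ^+ 2 - (1 + sqrt_kappa ^+ 2 - om * (x - c)) ^+ 2
  = om ^+ 2 * ((beta_p g xi - x) * (x - alpha_p g xi)).
  have -> : 4 * sqrt_kappa ^+ 2 - (1 + sqrt_kappa ^+ 2 - om * (x - c)) ^+ 2
    = ((1 + sqrt_kappa) ^+ 2 - om * (x - c))
      * (om * (x - c) - (1 - sqrt_kappa) ^+ 2) by ring.
  by rewrite -omega_alpha -omega_beta; ring.
rewrite (sqrtrM _ (sqr_ge0 om)) sqrtr_sqr gtr0_norm//.
move: (@pi R) (pi_gt0 R) => P P0.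
by field; rewrite !gt_eqF.
Qed.

End RescaledFamily.

Theorem theorem4 (R : realType) (g xi : R)
    (hg0 : 0 < g) (hg1 : g < 1) (hxi0 : g < xi) (hxi1 : xi < 1) :
  forall t : nat,
    (R_poly g xi t).[0] = 1 /\
    (size (R_poly g xi t) = t.+1)%N /\
    forall s : nat, s <> t ->
      (lebesgue_measure).-integrable
        `[alpha_p g xi, beta_p g xi]%classic
        (fun x => ((R_poly g xi s).[x] * (R_poly g xi t).[x] * weight g xi x)%:E) /\
      Rintegral lebesgue_measure `[alpha_p g xi, beta_p g xi]%classic
        (fun x => (R_poly g xi s).[x] * (R_poly g xi t).[x] * weight g xi x) = 0.
Proof.
move=> t; split.
  by rewrite R_polyE sub0r mulrN mulVf// gt_eqF// R_poly_norm_gt0.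
split; first exact: size_R_poly.
move=> s st.
set k := sqrt_kappa g xi; set om := omega_p g xi; set c := c_p g xi.
set a := alpha_p g xi; set b := beta_p g xi.
have k0 : 0 < k by exact: sqrt_kappa_gt0.
have k1 : k <= 1 by exact: sqrt_kappa_le1.
have om0 : 0 < om by exact: omega_p_gt0.
have ha : om * (a - c) = (1 - k) ^+ 2 by exact: omega_alpha.
have hb : om * (b - c) = (1 + k) ^+ 2 by exact: omega_beta.
pose p := Pi_poly (k ^+ 2) s * Pi_poly (k ^+ 2) t.
pose C := (Pi_poly (k ^+ 2) s).[- (om * c)]^-1
  * (Pi_poly (k ^+ 2) t).[- (om * c)]^-1 * (2 * pi * tau_p g xi)^-1.
set f := fun x : R => _ * weight g xi x.
(* Stated on the open interval only, where [x - c] is positive; the closed interval of the claim is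
   reached by discarding the endpoints. *)
have fE : {in `]a, b[,
    f =1 fun x => C * (p.[om * (x - c)] * mp_kernel k om c x)}.
  move=> x xab; rewrite /f !R_polyE weightE// kappa_pE hornerM /C -/k -/om -/c.
  ring.
have iP := mp_integrable k0 k1 om0 ha hb p.
have if_ : lebesgue_measure.-integrable `]a, b[ (EFin \o f).
  have iC : lebesgue_measure.-integrable `]a, b[
      (fun x => C%:E * (p.[om * (x - c)] * mp_kernel k om c x)%:E)%E.
    exact: integrableZl iP.
  apply: (eq_integrable _ _ _ _ iC) => //.
  by move=> x; rewrite inE/= => xab; rewrite /= fE.
split; first exact: integrable_itvoo_itvcc.
have /integrableP[mf _] := if_.
rewrite /Rintegral integral_itv_bndoo//.
transitivity (\int[lebesgue_measure]_(x in `]a, b[)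
    (C * (p.[om * (x - c)] * mp_kernel k om c x))).
  by apply: eq_Rintegral => x; rewrite inE/= => /fE.
rewrite RintegralZl// [X in C * X](mp_form_PiM k0 k1 om0 ha hb st).
by rewrite mulr0.
Qed.
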